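(* Let $c\ge 1$, $L>0$, $\mathcal{A}=[\underline{\alpha},\overline{\alpha}]$ with $\underline{\alpha}=\frac{1}{cL}$ and $\overline{\alpha}=\frac{c}{L}$, and for $\alpha\in\mathcal{A}$ let $A=I_n$, $B_u(\alpha)=-\alpha I_n$, $B_w(\alpha)=\alpha I_n$, $C_y=C_e=I_n$. Consider the gradient algorithm affected by gradient noise, with varying step sizes $\alpha_k\in\mathcal{A}$, $k\ge 0$, written as the linear parameter-varying system $$x_{k+1}=Ax_k+B_u(\alpha_k)u_k+B_w(\alpha_k)w_k,\qquad y_k=C_yx_k,\qquad e_k=C_ex_k,\qquad u_k=\phi(y_k),$$ initialized at some $x_0\in\mathbb{R}^n$, where $w_k$ is additive white stochastic noise with zero mean and identity covariance matrix. Suppose the nonlinear function $u=\phi(y)$ satisfies the pointwise IQC defined by a symmetric matrix $M\in\mathbb{R}^{2n\times 2n}$. Suppose that there exist a positive definite matrix $P\in\mathbb{R}^{n\times n}$ and a non-negative scalar $\lambda$ such that the following linear matrix inequality holds for all $\alpha\in\mathcal{A}$: $$\begin{bmatrix} A^TPA-P+C_e^TC_e & A^TPB_u(\alpha)\\ B_u^T(\alpha)PA & B_u^T(\alpha)PB_u(\alpha)\end{bmatrix}+\lambda\begin{bmatrix} C_y & 0_n\\ 0_n & I_n\end{bmatrix}^TM\begin{bmatrix} C_y & 0_n\\ 0_n & I_n\end{bmatrix}\preceq 0 .$$ Then the noise amplification metric $\gamma$ is bounded by $$\gamma\le\sup_{\alpha\in\mathcal{A}}\Big(\mathrm{tr}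\big(B_w^T(\alpha)PB_w(\alpha)\big)\Big)^{1/2}.$$
   Context: $I_n$ and $0_n$ denote the $n\times n$ identity and zero matrices; $\preceq 0$ means negative semidefinite; $\mathrm{tr}$ is the trace; $\|\cdot\|$ is the Euclidean norm. Setting: in gradient descent, $\phi=\nabla f$, where $f:\mathbb{R}^n\to\mathbb{R}$ is $m$-strongly convex, $\nabla f$ is $L$-Lipschitz continuous, and, without loss of generality by a coordinate shift, the unique minimizer of $f$ is $x^*=0$. The algorithm then reads $x_{k+1}=x_k-\alpha_k(\nabla f(x_k)+w_k)$. The step size $\alpha_k$ is produced by some line search; the only assumption made on it is that $\alpha_k\in\mathcal{A}$ at each time step $k$, with no bound on its rate of variation. Pointwise IQC (integral quadratic constraint): consider the sequences $y_k,u_k\in\mathbb{R}^n$ and let $z_k=\begin{bmatrix} y_k \\ u_k \end{bmatrix}\in\mathbb{R}^{2n}$. The nonlinear function $u_k=\phi(y_k)$ (static and memoryless) satisfies the pointwise IQC defined by $M$ if $z_k^TMz_k\ge 0$ for all $k\ge 0$. Noise: $\mathbb{E}[w_k]=0$ and $\mathbb{E}[w_kw_l^T]=I_n\delta_{k-l}$, where $\delta_0=1$ and $\delta_j=0$ for $j\ne 0$. Expectations are over different realizations of $w_k$. Noise amplification metric: $$\gamma=\Big(\lim_{N\to\infty}\frac1N\sum_{k=0}^N\mathbb{E}\big[\|x_k\|^2\big]\Big)^{1/2}=\Big(\lim_{N\to\infty}\mathbb{E}\big[\|x_N\|^2\big]\Big)^{1/2},$$ so that $\gamma^2$ is the steady-state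 variance of the iterate $x_N$ (equivalently of the iterate error $x_N-x^*$, since $x^*=0$). The limit exists when the update $x_{k+1}=x_k-\alpha_k(\nabla f(x_k)+w_k)$ is stable.
   Formalization: The white noise is assumed, beyond zero mean and identity covariance, to have zero conditional mean given the step sizes up to time k and the earlier noise (mere uncorrelatedness does not suffice); the limit defining γ is assumed to exist, possibly infinite. *)

(* Defs.v *)
From HB Require Import structures.
From mathcomp Require Import all_boot all_order all_algebra.
From mathcomp Require Import all_classical all_reals all_analysis.
Set Implicit Arguments.
Unset Strict Implicit.
Unset Printing Implicit Defensive.
Import Order.TTheory GRing.Theory Num.Theory.
Import numFieldNormedType.Exports.
Local Open Scope classical_set_scope.
Local Open Scope ring_scope.

Section LinearAlgebra.
Context {R : realType}.

(* The library norm on matrices is the max norm, hence a separate Euclidean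
   norm. *)
Definition dotv n (x y : 'cV[R]_n) : R := (x^T *m y) 0 0.

Definition enorm n (x : 'cV[R]_n) : R := Num.sqrt (dotv x x).

Definition qform n (M : 'M[R]_n) (x : 'cV[R]_n) : R := (x^T *m M *m x) 0 0.

Definition posdef n (M : 'M[R]_n) : Prop :=
  M^T = M /\ forall x : 'cV[R]_n, x != 0 -> 0 < qform M x.

Definition negsemidef n (M : 'M[R]_n) : Prop :=
  M^T = M /\ forall x : 'cV[R]_n, qform M x <= 0.

End LinearAlgebra.

Section Objective.
Context {R : realType} {n : nat}.

Definition strongly_convex (m : R) (f : 'cV[R]_n -> R) : Prop :=
  forall (x y : 'cV[R]_n) (t : R), 0 <= t <= 1 ->
    f (t *: x + (1 - t) *: y) <=
      t * f x + (1 - t) * f y - m / 2 * (t * (1 - t)) * enorm (x - y) ^+ 2.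

(* Fréchet differentiability does not depend on the norm chosen on R^n. *)
Definition is_gradient (f : 'cV[R]_n -> R) (g : 'cV[R]_n -> 'cV[R]_n) : Prop :=
  forall x : 'cV[R]_n, is_diff x (f : 'cV[R]_n -> R^o) (dotv (g x) : _ -> R^o).

Definition elipschitz (L : R) (g : 'cV[R]_n -> 'cV[R]_n) : Prop :=
  forall x y : 'cV[R]_n, enorm (g x - g y) <= L * enorm (x - y).

(* A property of phi itself: it is required along every sequence y, not only
   along the iterates of a particular algorithm. *)
Definition pointwise_IQC (M : 'M[R]_(n + n)) (phi : 'cV[R]_n -> 'cV[R]_n) :
    Prop :=
  forall y u : nat -> 'cV[R]_n, (forall k, u k = phi (y k)) ->
    forall k, 0 <= qform M (col_mx (y k) (u k)).

End Objective.

Section GradientLPV.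
Context {R : realType} (n : nat).

Definition gd_A : 'M[R]_n := 1%:M.
Definition gd_Bu (a : R) : 'M[R]_n := (- a)%:M.
Definition gd_Bw (a : R) : 'M[R]_n := a%:M.
Definition gd_Cy : 'M[R]_n := 1%:M.
Definition gd_Ce : 'M[R]_n := 1%:M.

Definition step_sizes (c L : R) : set R := `[1 / (c * L), c / L].

Definition gd_lmi (P : 'M[R]_n) (lambda : R) (M : 'M[R]_(n + n)) (a : R) :
    'M[R]_(n + n) :=
  block_mx (gd_A^T *m P *m gd_A - P + gd_Ce^T *m gd_Ce)
           (gd_A^T *m P *m gd_Bu a)
           ((gd_Bu a)^T *m P *m gd_A)
           ((gd_Bu a)^T *m P *m gd_Bu a)
  + lambda *: ((block_mx gd_Cy 0 0 1%:M)^T *m M *m block_mx gd_Cy 0 0 1%:M).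

End GradientLPV.

Section Stochastic.
Context {d : measure_display} {Omega : measurableType d} {R : realType}
  (Pr : probability Omega R).
Variable n : nat.
Implicit Types (alpha : nat -> {RV Pr >-> R}) (w : nat -> 'I_n -> {RV Pr >-> R}).

Definition noise w (k : nat) (omega : Omega) : 'cV[R]_n :=
  \col_i w k i omega.

(* The sigma-algebra generated by alpha_0, ..., alpha_k and
   w_0, ..., w_(k-1), i.e. what is known when w_k is drawn. *)
Definition history alpha w (k : nat) : set (set Omega) :=
  <<s (\bigcup_(j in [set j | (j <= k)%N])
         preimage_set_system setT (alpha j) measurable) `|`
      (\bigcup_(j in [set j | (j < k)%N]) \bigcup_(i in [set: 'I_n])
         preimage_set_system setT (w j i) measurable) >>.

(* The moment conditions E[w_k] = 0 and E[w_k w_l^T] = I delta_(k-l), together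
   with E[w_k | history] = 0, spelled out as a null integral over every event
   of the history. The latter is implied by the independence of w_k from the
   history, in particular when the noise is independent in time and the step
   sizes are deterministic or chosen from the current and past iterates. It
   cannot be dropped: x_k and phi(x_k) are nonlinear functions of the past
   noise, so uncorrelatedness alone leaves cross terms between w_k and the
   state. *)
Definition white_noise alpha w : Prop :=
  [/\ forall k i, ('E_Pr[w k i] = 0)%E,
      forall k l i j, ('E_Pr[fun omega => (w k i omega * w l j omega)%R] =
                         (((k == l) && (i == j))%:R)%:E)%E &
      forall k i S, history alpha w k S ->
        (\int[Pr]_(omega in S) (w k i omega)%:E = 0)%E].

(* (1/N) \sum_(k = 0)^N E[|x_k|^2]; the value at N = 0 is irrelevant. *)
Definition mean_square_average (x : nat -> Omega -> 'cV[R]_n) (N : nat) :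
    \bar R :=
  ((N%:R^-1)%:E *
     \sum_(0 <= k < N.+1) 'E_Pr[fun omega => (enorm (x k omega) ^+ 2)%R])%E.

(* limn is only meaningful under cvgn (mean_square_average x), which holds in
   particular whenever E[|x_N|^2] converges, with the same limit. *)
Definition noise_amplification (x : nat -> Omega -> 'cV[R]_n) : \bar R :=
  sqrte (limn (mean_square_average x)).

End Stochastic.

(* Main.v *)
Require Import Defs.
From HB Require Import structures.
From mathcomp Require Import all_boot all_order all_algebra.
From mathcomp Require Import all_classical all_reals all_analysis.
From mathcomp Require Import measurable_realfun ring lra.
Set Implicit Arguments.
Unset Strict Implicit.
Unset Printing Implicit Defensive.
Import Order.TTheory GRing.Theory Num.Theory.
Import numFieldNormedType.Exports.
Local Open Scope classical_set_scope.
Local Open Scope ring_scope.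

(** The quadratic form [V(x) = x^T P x] is a Lyapunov function. Write
[xi_k = x_k - alpha_k phi(x_k)] for the noise-free update. Evaluating the
matrix inequality at the vector [(x_k, phi(x_k))], where the constraint on
[phi] makes the [M] term nonnegative, gives the dissipation inequality
[V(xi_k) + |x_k|^2 <= V(x_k)] ([lmi_dissipation]). Since
[x_(k+1) = xi_k + alpha_k w_k], expanding the quadratic form yields

  [V(x_(k+1)) + |x_k|^2
     <= V(x_k) + 2 alpha_k (P xi_k)^T w_k + alpha_k^2 V(w_k)].

In expectation, the cross term vanishes, because [alpha_k P xi_k] is a function
of what is known when [w_k] is drawn; and [alpha_k^2 V(w_k)] is at most
[abar^2 V(w_k)] with [abar = c / L] the largest step size, whose expectation is
[abar^2 tr P] because the covariance of [w_k] is the identity; bounding the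
random factor [alpha_k^2] before taking the expectation leaves only this
unconditional covariance. Summing over [k] telescopes [V]
([sum_mean_square_le]), so the averages of [E |x_k|^2] have a limit at most
[abar^2 tr P], and the supremum in the theorem is at least its value at
[a = abar], which is the square root of this number.

The probabilistic content is the vanishing of the cross term. It is assumed that
[w_k] integrates to zero over every event of the history; this extends to
[E[w_k g] = 0] for every history-measurable [g] with [w_k g] integrable
([integral_orthogonal]), by approximating [g] by simple functions. Two facts
make it applicable. First, the state is adapted to the history: here [phi] has
to preserve measurability, which is derived from its Lipschitz bound
([measurable_lipschitz_comp]). Second, the products are integrable: the energy
[E V(x_k)] stays finite along the recursion ([energy_integrable]), and the
positivity of [P] bounds each product [(P xi)_i w_i] by
[V(xi)] and [w_i^2] ([cross_term_bound]). *)

(** * Quadratic forms and the dissipation inequality *)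

Section QuadraticForms.
Context {R : realType} {n : nat}.
Implicit Types (x y u : 'cV[R]_n) (P : 'M[R]_n).

Lemma dotvE x y : dotv x y = \sum_i x i 0 * y i 0.
Proof. by rewrite /dotv mxE; apply: eq_bigr => i _; rewrite mxE. Qed.

Lemma dotv_ge0 x : 0 <= dotv x x.
Proof. by rewrite dotvE sumr_ge0// => i _; rewrite -expr2 sqr_ge0. Qed.

Lemma enorm_sqr x : enorm x ^+ 2 = dotv x x.
Proof. by rewrite sqr_sqrtr ?dotv_ge0. Qed.

Lemma normr_coord_le_enorm x i : `|x i 0| <= enorm x.
Proof.
rewrite -sqrtr_sqr ler_wsqrtr// dotvE (bigD1 i)//= -expr2 lerDl.
by rewrite sumr_ge0// => j _; rewrite -expr2 sqr_ge0.
Qed.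

Lemma qformE P x : qform P x = \sum_i \sum_j P i j * (x i 0 * x j 0).
Proof.
rewrite /qform mxE exchange_big/=; apply: eq_bigr => j _.
rewrite mxE mulr_suml; apply: eq_bigr => i _; rewrite mxE; ring.
Qed.

Lemma bilinear_formC P x y : P^T = P ->
  (y^T *m P *m x) 0 0 = (x^T *m P *m y) 0 0.
Proof.
move=> sP; transitivity ((y^T *m P *m x)^T 0 0); first by rewrite [RHS]mxE.
by rewrite !trmx_mul sP trmxK mulmxA.
Qed.

Lemma qformD P x y : P^T = P ->
  qform P (x + y) = qform P x + 2 * dotv (P *m x) y + qform P y.
Proof.
move=> sP; have ->: dotv (P *m x) y = (x^T *m P *m y) 0 0.
  by rewrite /dotv trmx_mul sP.
have yx := bilinear_formC x y sP.
rewrite /qform !mulmxDr (raddfD (@trmx R n 1))/= !mulmxDl.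
have mxD (A B : 'M[R]_1) : (A + B) 0 0 = A 0 0 + B 0 0 by rewrite mxE.
rewrite !mxD yx; ring.
Qed.

Lemma qformZ P a x : qform P (a *: x) = a ^+ 2 * qform P x.
Proof. rewrite !qformE mulr_sumr; apply: eq_bigr => i _; rewrite mulr_sumr.
by apply: eq_bigr => j _; rewrite !mxE; ring. Qed.

Lemma qformN P x : qform P (- x) = qform P x.
Proof. by rewrite -scaleN1r qformZ sqrrN expr1n mul1r. Qed.

Lemma posdef_qform_ge0 P x : posdef P -> 0 <= qform P x.
Proof.
move=> [_ P0]; have [->|x0] := eqVneq x 0; last exact/ltW/P0.
by rewrite /qform mulmx0 mxE.
Qed.

(** This is [V (x + y) + V (x - y) = 2 V x + 2 V y] with [V (x - y) >= 0]. *)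
Lemma qformD_le P x y : posdef P ->
  qform P (x + y) <= 2 * qform P x + 2 * qform P y.
Proof.
move=> P0; have := posdef_qform_ge0 (x - y) P0.
rewrite !qformD ?(proj1 P0)// qformN.
have -> : dotv (P *m x) (- y) = - dotv (P *m x) y by rewrite /dotv mulmxN mxE.
lra.
Qed.

(** A Cauchy-Schwarz inequality for [P], between [x] and a multiple of the
i-th basis vector, in the additive form that gives integrability of a product
from that of two squares. It follows from the positivity of [P] at
[x + t e_i] and [x - t e_i]. *)
Lemma cross_term_bound P x t i : posdef P ->
  2 * `|(P *m x) i 0 * t| <= qform P x + P i i * t ^+ 2.
Proof.
move=> P0; pose e : 'cV[R]_n := delta_mx i 0.
have Pe : qform P e = P i i.
  rewrite /qform /e trmx_delta -rowE -colE !mxE//.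
have de s : dotv (P *m x) (s *: e) = (P *m x) i 0 * s.
  rewrite dotvE (bigD1 i)//= big1 ?addr0; first by rewrite !mxE !eqxx/= mulr1.
  by move=> j ji; rewrite !mxE (negbTE ji)/= !mulr0.
have h s := posdef_qform_ge0 (x + s *: e) P0.
have := h t; have := h (- t); rewrite !qformD ?(proj1 P0)// !de !qformZ Pe.
move: (_ i 0) => p; rewrite sqrrN; have [_|_] := ger0P (p * t); lra.
Qed.

(** At the vector [(x, u)] the quadratic form of the matrix inequality is
[V (x - a u) - V x + |x|^2 + lambda (x, u)^T M (x, u)]. *)
Lemma lmi_dissipation P lambda (M : 'M[R]_(n + n)) a x u :
  P^T = P -> 0 <= lambda -> negsemidef (gd_lmi P lambda M a) ->
  0 <= qform M (col_mx x u) ->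
  qform P (x - a *: u) + dotv x x <= qform P x.
Proof.
move=> sP l0 [_ /(_ (col_mx x u))] + M0.
suff -> : qform (gd_lmi P lambda M a) (col_mx x u) =
    qform P (x - a *: u) - qform P x + dotv x x
    + lambda * qform M (col_mx x u).
  have := mulr_ge0 l0 M0; lra.
rewrite qformD// qformN qformZ /gd_lmi /gd_A /gd_Ce /gd_Cy /gd_Bu.
rewrite -scalar_mx_block !trmx1 !mulmx1 !mul1mx tr_scalar_mx.
rewrite mul_scalar_mx !mul_mx_scalar.
rewrite /qform mulmxDr mulmxDl [in LHS]mxE; congr (_ + _); last first.
  by rewrite -scalemxAr -scalemxAl mxE.
rewrite tr_col_mx mul_row_block mul_row_col /dotv.
rewrite subrr add0r mulmx1 trmx_mul sP -scaleNr !mulmxDl.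
rewrite !(=^~ scalemxAr, =^~ scalemxAl).
move: (bilinear_formC x u sP); move: (u^T *m P *m x) (x^T *m P *m u) => A B.
move: (x^T *m P *m x) (u^T *m P *m u) (x^T *m x) => C D E AB.
by rewrite !mxE AB; ring.
Qed.

End QuadraticForms.

(** * Measurability of Lipschitz images *)

Section LipschitzMeasurable.
Context {R : realType} {n : nat}.

Lemma rational_vector_dense (x : 'cV[R]_n) (e : R) : 0 < e ->
  exists q : 'cV[rat]_n, enorm (x - map_mx ratr q) < e.
Proof.
move=> e0.
(* With every coordinate within dlt, the squared distance is at most
   n dlt^2, which is less than (n + 1)^2 dlt^2 = e^2. *)
pose dlt : R := e / (n%:R + 1).
have n1 : 0 < n%:R + 1 :> R by rewrite ltr_wpDl.
have d0 : 0 < dlt by rewrite divr_gt0.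
have dE : e = (n%:R + 1) * dlt by rewrite mulrC divfK// gt_eqF.
clearbody dlt.
have /boolp.choice[q hq] : forall i, exists q : rat, `|x i 0 - ratr q| < dlt.
  move=> i.
  have [|q] := @rat_in_itvoo R (x i 0 - dlt) (x i 0 + dlt); first lra.
  by rewrite in_itv/= => qI; exists q; rewrite ltr_norml; lra.
exists (\col_i q i).
rewrite -(ltr_pXn2r (_ : 0 < 2)%N) ?nnegrE ?sqrtr_ge0//; last exact: ltW.
rewrite enorm_sqr dotvE (@le_lt_trans _ _ (\sum_(i < n) dlt ^+ 2))//.
  apply: ler_sum => i _; rewrite -expr2 -[leLHS]real_normK ?num_real//.
  by rewrite lerXn2r ?nnegrE// ?(ltW d0)// !mxE ltW.
rewrite sumr_const card_ord dE exprMn -[ltLHS]mulr_natl ltr_pM2r ?exprn_gt0//.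
have : 0 <= n%:R :> R by []. nra.
Qed.

Context {d : measure_display} {T : measurableType d}.

Lemma measurable_dotv (X Y : T -> 'cV[R]_n) :
  (forall i, measurable_fun setT (fun t => X t i 0)) ->
  (forall i, measurable_fun setT (fun t => Y t i 0)) ->
  measurable_fun setT (fun t => dotv (X t) (Y t)).
Proof.
move=> mX mY; under eq_fun do rewrite dotvE.
by apply: measurable_sum => i; exact: measurable_funM.
Qed.

Lemma measurable_enorm (X : T -> 'cV[R]_n) :
  (forall i, measurable_fun setT (fun t => X t i 0)) ->
  measurable_fun setT (fun t => enorm (X t)).
Proof.
move=> mX; apply: (@measurableT_comp _ _ _ _ _ _ (@Num.sqrt R)).
  by apply: continuous_measurable_fun; exact: sqrt_continuous.
exact: measurable_dotv.
Qed.

(** A Lipschitz function is the lower envelope of the countably many cones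
[g q + L |x - q|] with rational apex [q], so that its strict sublevel sets are
countable unions of sublevel sets of distances, which depend on the coordinates
of [X] by sums, squares and a square root. *)
Lemma measurable_lipschitz_comp (g : 'cV[R]_n -> R) (L : R)
    (X : T -> 'cV[R]_n) : 0 <= L ->
  (forall x y, `|g x - g y| <= L * enorm (x - y)) ->
  (forall i, measurable_fun setT (fun t => X t i 0)) ->
  measurable_fun setT (g \o X).
Proof.
move=> L0 gL mX.
apply: (measurability _ (RGenInftyO.measurableE R)) => // _ [_ [r ->]] <-.
rewrite setTI.
rewrite (_ : _ @^-1` _ = \bigcup_(q : 'cV[rat]_n)
   [set t | g (map_mx ratr q) + L * enorm (X t - map_mx ratr q) < r]).
  apply: countable_bigcupT_measurable => // q.
  pose F t := g (map_mx ratr q) + L * enorm (X t - map_mx ratr q).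
  have mF : measurable_fun setT F.
    apply: measurable_funD; first exact: measurable_cst.
    apply: measurable_funM; first exact: measurable_cst.
    apply: measurable_enorm => i; under eq_fun do rewrite !mxE.
    by apply: measurable_funD => //; exact: measurable_cst.
  have := mF measurableT _ (measurable_itv `]-oo, r[).
  by rewrite setTI.
apply/seteqP; split => t /=.
  rewrite in_itv/= => gr.
  (* Radius chosen so that 2 L |X t - q| < r - g (X t): one L bounds g q,
     the other is the slope of the cone. The 1 covers L = 0. *)
  have [|q hq] := rational_vector_dense (X t)
      (_ : 0 < (r - g (X t)) / (2 * L + 1)).
    by rewrite divr_gt0; lra.
  exists q => //=.
  rewrite ltr_pdivlMr in hq; last lra.
  have := gL (X t) (map_mx ratr q).
  have := sqrtr_ge0 (dotv (X t - map_mx ratr q) (X t - map_mx ratr q)).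
  rewrite -/(enorm _); move: (enorm _) hq => E hq E0; rewrite ler_norml.
  nra.
move=> [q _ /=]; rewrite in_itv/=.
have := gL (X t) (map_mx ratr q); rewrite ler_norml; lra.
Qed.

End LipschitzMeasurable.

(** * Orthogonality to a sub-sigma-algebra *)

Section Orthogonality.
Context {d : measure_display} {T : measurableType d} {R : realType}
  (mu : {measure set T -> \bar R}).
Variables (G : set (set T)) (W : T -> R).
Hypothesis (mG : <<s G >> `<=` measurable).
Hypothesis (iW : mu.-integrable setT (EFin \o W)).
Hypothesis (W0 : forall S, <<s G >> S -> (\int[mu]_(t in S) (W t)%:E = 0)%E).
Local Notation TG := (g_sigma_algebraType G).

Lemma measurable_fun_sub_sigma_algebra d' (U : measurableType d') (g : T -> U) :
  measurable_fun (setT : set TG) (g : TG -> U) -> measurable_fun setT g.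
Proof. by move=> mg _ B mB; apply: mG; exact: (mg measurableT B mB). Qed.

Import HBNNSimple.

Lemma integrable_dominated_mul (g h : T -> R) : measurable_fun setT h ->
  (forall t, `|h t| <= `|g t|) ->
  mu.-integrable setT (fun t => (W t * g t)%:E) ->
  mu.-integrable setT (fun t => (W t * h t)%:E).
Proof.
have /measurable_EFinP mW := measurable_int _ iW.
move=> mh hg; apply: le_integrable => //.
  by apply/measurable_EFinP; exact: measurable_funM.
by move=> t _ /=; rewrite lee_fin !normrM ler_wpM2l.
Qed.

(** A simple function is a finite combination of indicators of events of
[<<s G >>], over each of which [W] integrates to zero. *)
Lemma integral_orthogonal_nnsfun (s : {nnsfun TG >-> R}) :
  (\int[mu]_t (W t * s t)%:E = 0)%E.
Proof.
pose r := finmap.enum_fset (fset_set (range s)).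
pose A i := s @^-1` [set r`_i] : set T.
have mA i : <<s G >> (A i) by exact: (measurable_sfunP s).
have iA i : mu.-integrable setT (fun t => (W t * \1_(A i) t)%:E).
  apply: (integrable_dominated_mul (g := cst 1)).
  - exact/measurable_indic/mG.
  - move=> t; rewrite normr1 indicE.
    by case: (_ \in _); rewrite ?normr1 ?normr0.
  - by under eq_fun do rewrite mulr1.
transitivity (\int[mu]_t
    (\sum_(i < size r) (r`_i)%:E * (W t * \1_(A i) t)%:E))%E.
  apply: eq_integral => t _; rewrite fimfunEord -/r mulr_sumr -sumEFin.
  by apply: eq_bigr => i _; rewrite mulrCA.
rewrite integral_sum//; last by move=> i; exact: integrableZl.
apply: big1 => i _; rewrite integralZl//.
transitivity ((r`_i)%:E * \int[mu]_(t in A i) (W t)%:E)%E; last first.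
  by rewrite W0 ?mule0.
congr (_ * _)%E; rewrite [RHS]integral_mkcond; apply: eq_integral => t _.
by rewrite patchE indicE; case: ifP; rewrite ?mulr1 ?mulr0.
Qed.

(** Dominated convergence: the simple approximations [s k] of [g] satisfy
[0 <= s k <= g], so [|W g|] dominates every [W s k]. *)
Lemma integral_orthogonal_ge0 (g : T -> R) : (forall t, 0 <= g t) ->
  measurable_fun (setT : set TG) (g : TG -> R) ->
  mu.-integrable setT (fun t => (W t * g t)%:E) ->
  (\int[mu]_t (W t * g t)%:E = 0)%E.
Proof.
move=> g0 mg iWg.
have mg' : measurable_fun (setT : set TG) (EFin \o g : TG -> \bar R).
  exact/measurable_EFinP.
pose s := nnsfun_approx measurableT mg'.
have s_cvg t : EFin (s k t) @[k --> \oo] --> (g t)%:E.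
  apply: (@cvg_nnsfun_approx _ _ _ _ measurableT _ mg') => // x _.
  by rewrite lee_fin.
have s_le k t : s k t <= g t.
  rewrite -lee_fin nnsfun_approxE; apply: le_approx => // x _.
  by rewrite lee_fin.
have mgT := measurable_fun_sub_sigma_algebra mg.
have msT k : measurable_fun setT (s k : T -> R).
  by apply: measurable_fun_sub_sigma_algebra; exact: measurable_funP.
have /measurable_EFinP mW := measurable_int _ iW.
have [|||||_ _ h] := @dominated_convergence _ _ _ mu setT measurableT
  (fun k t => (W t * s k t)%:E) (fun t => (W t * g t)%:E)
  (fun t => `|(W t * g t)%:E|)%E.
- by move=> k; apply/measurable_EFinP; exact: measurable_funM.
- exact: measurable_int iWg.
- apply: aeW => t _; under eq_fun do rewrite EFinM.
  by rewrite EFinM; apply: cvgeZl => //; exact: s_cvg.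
- exact: integrable_abse.
- apply: aeW => t k _; rewrite !abse_EFin lee_fin !normrM ler_wpM2l//.
  by rewrite !ger0_norm.
apply/esym; move: h; under eq_fun do rewrite integral_orthogonal_nnsfun.
by move/cvg_lim => <-//; rewrite lim_cst.
Qed.

(** This is the identity [E[W g] = E[E[W | G] g]] when the conditional
expectation [E[W | G]] vanishes. Only the product is assumed integrable, since
the application has [g] unbounded. *)
Lemma integral_orthogonal (g : T -> R) :
  measurable_fun (setT : set TG) (g : TG -> R) ->
  mu.-integrable setT (fun t => (W t * g t)%:E) ->
  (\int[mu]_t (W t * g t)%:E = 0)%E.
Proof.
move=> mg iWg.
have mp : measurable_fun (setT : set TG) (g^\+ : TG -> R).
  exact: measurable_funrpos.
have mn : measurable_fun (setT : set TG) (g^\- : TG -> R).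
  exact: measurable_funrneg.
have ip : mu.-integrable setT (fun t => (W t * g^\+ t)%:E).
  apply: integrable_dominated_mul iWg.
    exact: measurable_fun_sub_sigma_algebra.
  move=> t; rewrite ger0_norm ?funrpos_ge0//.
  by rewrite /funrpos ge_max ler_norm normr_ge0.
have im : mu.-integrable setT (fun t => (W t * g^\- t)%:E).
  apply: integrable_dominated_mul iWg.
    exact: measurable_fun_sub_sigma_algebra.
  move=> t; rewrite ger0_norm ?funrneg_ge0//.
  by rewrite /funrneg ge_max normr_ge0 -normrN ler_norm.
transitivity (\int[mu]_t ((W t * g^\+ t)%:E - (W t * g^\- t)%:E))%E.
  apply: eq_integral => t _; rewrite -EFinB -mulrBr; congr (_ * _)%:E.
  by rewrite -[in LHS](funrposBneg g).
rewrite integralB// !integral_orthogonal_ge0 ?sube0//.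
Qed.

End Orthogonality.

(** * Integrability of real-valued functions *)

Section RealIntegrable.
Context {d : measure_display} {T : measurableType d} {R : realType}
  {mu : {measure set T -> \bar R}}.
Implicit Types f g : T -> R.

Lemma le_integrableR f g : measurable_fun setT f ->
  (forall t, `|f t| <= g t) -> mu.-integrable setT (EFin \o g) ->
  mu.-integrable setT (EFin \o f).
Proof.
move=> mf fg; apply: le_integrable => //; first exact/measurable_EFinP.
by move=> t _ /=; rewrite lee_fin (le_trans (fg t))// ler_norm.
Qed.

Lemma integrableDR f g : mu.-integrable setT (EFin \o f) ->
  mu.-integrable setT (EFin \o g) ->
  mu.-integrable setT (EFin \o (fun t => f t + g t)).
Proof. by move=> fi gi; exact: (integrableD measurableT fi gi). Qed.

Lemma integrableZR (a : R) f : mu.-integrable setT (EFin \o f) ->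
  mu.-integrable setT (EFin \o (fun t => a * f t)).
Proof. by move=> fi; exact: (integrableZl measurableT a fi). Qed.

End RealIntegrable.

(** * The filtration of the past *)

Section History.
Context {d : measure_display} {Omega : measurableType d} {R : realType}
  {Pr : probability Omega R} {n : nat}.
Variables (alpha : nat -> {RV Pr >-> R}) (w : nat -> 'I_n -> {RV Pr >-> R}).

(** The generators of [history alpha w k], named so that the history carries a
measurable type, which the closure properties of measurable functions and the
approximation by simple functions apply to. *)
Definition history_events (k : nat) : set (set Omega) :=
  (\bigcup_(j in [set j | (j <= k)%N])
     preimage_set_system setT (alpha j) measurable) `|`
  (\bigcup_(j in [set j | (j < k)%N]) \bigcup_(i in [set: 'I_n])
     preimage_set_system setT (w j i) measurable).

Definition adapted (k : nat) (f : Omega -> R) : Prop :=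
  measurable_fun (setT : set (g_sigma_algebraType (history_events k)))
    (f : g_sigma_algebraType (history_events k) -> R).

Lemma history_measurable k : history alpha w k `<=` measurable.
Proof.
apply: smallest_sub; first exact: sigma_algebra_measurable.
move=> A [[j _ [B mB <-]]|[j _ [i _ [B mB <-]]]].
  by rewrite setTI; exact: (measurable_funPTI (alpha j)).
by rewrite setTI; exact: (measurable_funPTI (w j i)).
Qed.

Lemma adapted_measurable k f : adapted k f -> measurable_fun setT f.
Proof. exact: (measurable_fun_sub_sigma_algebra (@history_measurable k)). Qed.

Lemma adaptedS k f : adapted k f -> adapted k.+1 f.
Proof.
move=> af _ B mB; move: (af measurableT B mB).
apply: sub_sigma_algebra2 => A [[j jk Aj]|[j jk Aj]].
  by left; exists j => //=; rewrite leqW.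
by right; exists j => //=; rewrite ltnW.
Qed.

Lemma adapted_step k : adapted k (alpha k).
Proof.
move=> _ B mB; apply: sub_sigma_algebra; left; exists k => //=.
by exists B.
Qed.

Lemma adapted_noise k i : adapted k.+1 (w k i).
Proof.
move=> _ B mB; apply: sub_sigma_algebra; right; exists k => //=.
by exists i => //; exists B.
Qed.

End History.

(** * Moments of the noise *)

Section WhiteNoise.
Context {d : measure_display} {Omega : measurableType d} {R : realType}
  {Pr : probability Omega R} {n : nat}.
Variables (alpha : nat -> {RV Pr >-> R}) (w : nat -> 'I_n -> {RV Pr >-> R}).
Hypothesis hw : white_noise alpha w.

(** The square equals its absolute value, so the integral of the latter is the
given second moment, which is finite. *)
Lemma white_noise_sqr_integrable k i :
  Pr.-integrable setT (EFin \o (fun omega => w k i omega ^+ 2)).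
Proof.
apply/integrableP; split.
  by apply/measurable_EFinP; exact: measurable_funX.
have [_ /(_ k k i i) + _] := hw; rewrite !eqxx unlock => h.
under eq_integral do rewrite /= ger0_norm ?sqr_ge0// expr2.
by rewrite h ltry.
Qed.

Lemma white_noise_prod_integrable k i j :
  Pr.-integrable setT (EFin \o (fun omega => w k i omega * w k j omega)).
Proof.
apply: (@le_integrableR _ _ _ _ _
    (fun omega => w k i omega ^+ 2 + w k j omega ^+ 2)).
- exact: measurable_funM.
- move=> t; move: (w k i t) (w k j t) => a b; rewrite ler_norml.
  have := sqr_ge0 (a + b); have := sqr_ge0 (a - b); nra.
- by apply: integrableDR; exact: white_noise_sqr_integrable.
Qed.

Lemma white_noise_integrable k i : Pr.-integrable setT (EFin \o w k i).
Proof.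
apply: (@le_integrableR _ _ _ _ _ (fun omega => 1 + w k i omega ^+ 2)) => //.
- move=> t; move: (w k i t) => a; rewrite ler_norml.
  have := sqr_ge0 (a + 1); have := sqr_ge0 (a - 1); nra.
- apply: integrableDR; last exact: white_noise_sqr_integrable.
  exact: finite_measure_integrable_cst.
Qed.

Lemma qform_noise_integrable (P : 'M[R]_n) k :
  Pr.-integrable setT (EFin \o (fun omega => qform P (noise w k omega))).
Proof.
apply: (@eq_integrable _ _ _ _ _ _
  (fun omega => \sum_i \sum_j (P i j * (w k i omega * w k j omega))%:E)%E)
  => //.
  move=> t _ /=; rewrite qformE -sumEFin; apply: eq_bigr => i _.
  by rewrite -sumEFin; apply: eq_bigr => j _; rewrite !mxE.
apply: integrable_sum => // i _; apply: integrable_sum => // j _.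
by apply: integrableZR; exact: white_noise_prod_integrable.
Qed.

Lemma expectation_qform_noise (P : 'M[R]_n) k :
  \int[Pr]_omega qform P (noise w k omega) = \tr P.
Proof.
rewrite /Rintegral.
transitivity (fine (\int[Pr]_omega
    (\sum_i \sum_j (P i j * (w k i omega * w k j omega))%:E))%E).
  congr fine; apply: eq_integral => t _; rewrite qformE -sumEFin.
  apply: eq_bigr => i _; rewrite -sumEFin.
  by apply: eq_bigr => j _; rewrite !mxE.
have iw i j : Pr.-integrable setT
    (fun omega => (P i j * (w k i omega * w k j omega))%:E).
  by apply: integrableZR; exact: white_noise_prod_integrable.
rewrite integral_sum//; last by move=> i; apply: integrable_sum.
under eq_bigr do rewrite integral_sum//.
transitivity (fine (\sum_i \sum_j (P i j * (i == j)%:R)%:E)%E).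
  congr fine; apply: eq_bigr => i _; apply: eq_bigr => j _.
  under eq_integral do rewrite EFinM.
  rewrite integralZl//; last exact: white_noise_prod_integrable.
  have [_ /(_ k k i j) + _] := hw; rewrite eqxx unlock => h.
  by rewrite EFinM; congr (_ * _)%E.
under eq_bigr do rewrite sumEFin.
rewrite sumEFin/=; apply: eq_bigr => i _.
rewrite (bigD1 i)//= eqxx mulr1 big1 ?addr0// => j ji.
by rewrite eq_sym (negbTE ji) mulr0.
Qed.

Lemma expectation_adapted_noise k i g : adapted alpha w k g ->
  Pr.-integrable setT (EFin \o (fun omega => w k i omega * g omega)) ->
  \int[Pr]_omega (w k i omega * g omega) = 0.
Proof.
move=> ag ig; rewrite /Rintegral.
rewrite (integral_orthogonal (@history_measurable _ _ _ _ _ alpha w k)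
  (white_noise_integrable k i) _ ag ig)//.
by have [_ _ h] := hw; move=> S; exact: h.
Qed.

End WhiteNoise.

(** * The closed loop *)

Section ClosedLoop.
Context {d : measure_display} {Omega : measurableType d} {R : realType}
  {Pr : probability Omega R} {n : nat}.
Variables (alpha : nat -> {RV Pr >-> R}) (w : nat -> 'I_n -> {RV Pr >-> R}).
Variables (P : 'M[R]_n) (phi : 'cV[R]_n -> 'cV[R]_n) (L abar : R).
Variables (x0 : 'cV[R]_n) (x : nat -> Omega -> 'cV[R]_n).
Hypothesis hw : white_noise alpha w.
Hypothesis P0 : posdef P.
Hypothesis L0 : 0 <= L.
Hypothesis phi_lip : elipschitz L phi.
Hypothesis alphaI : forall k omega, 0 <= alpha k omega <= abar.

Let xi k omega := x k omega - alpha k omega *: phi (x k omega).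

Hypothesis xinit : forall omega, x 0%N omega = x0.
Hypothesis xS : forall k omega,
  x k.+1 omega = xi k omega + alpha k omega *: noise w k omega.
Hypothesis dissipation : forall k omega,
  qform P (xi k omega) + dotv (x k omega) (x k omega) <= qform P (x k omega).

(** The coordinates of [phi] are Lipschitz because a coordinate is at most the
Euclidean norm. *)
Lemma drift_adapted k :
  (forall i, adapted alpha w k (fun omega => x k omega i 0)) ->
  forall i, adapted alpha w k (fun omega => xi k omega i 0).
Proof.
move=> ax i; rewrite /adapted /xi; under eq_fun do rewrite !mxE.
apply: measurable_funB; first exact: ax.
apply: measurable_funM; first exact: adapted_step.
apply: (@measurable_lipschitz_comp _ _ _ _ (fun z => phi z i 0) L) => // a b.
apply: le_trans (phi_lip a b).
by have := normr_coord_le_enorm (phi a - phi b) i; rewrite !mxE.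
Qed.

Lemma state_adapted k i : adapted alpha w k (fun omega => x k omega i 0).
Proof.
elim: k i => [|k IH] i.
  rewrite /adapted; under eq_fun do rewrite xinit; exact: measurable_cst.
have xE omega :
    x k.+1 omega i 0 = xi k omega i 0 + alpha k omega * w k i omega.
  by rewrite xS !mxE.
rewrite /adapted; under eq_fun do rewrite xE.
apply: measurable_funD; first exact: (adaptedS (drift_adapted IH i)).
apply: measurable_funM.
  exact: (adaptedS (@adapted_step _ _ _ _ _ alpha w k)).
exact: adapted_noise.
Qed.

Lemma state_measurable k i : measurable_fun setT (fun omega => x k omega i 0).
Proof. exact: (adapted_measurable (@state_adapted k i)). Qed.

Lemma drift_measurable k i :
  measurable_fun setT (fun omega => xi k omega i 0).
Proof. exact: (adapted_measurable (drift_adapted (@state_adapted k) i)). Qed.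

Lemma measurable_qform (X : Omega -> 'cV[R]_n) :
  (forall i, measurable_fun setT (fun omega => X omega i 0)) ->
  measurable_fun setT (fun omega => qform P (X omega)).
Proof.
move=> mX; under eq_fun do rewrite qformE.
apply: measurable_sum => i; apply: measurable_sum => j.
by apply: measurable_funM => //; exact: measurable_funM.
Qed.

Lemma noise_gain_le k omega :
  alpha k omega ^+ 2 * qform P (noise w k omega) <=
  abar ^+ 2 * qform P (noise w k omega).
Proof.
have /andP[a0 aM] := alphaI k omega.
by rewrite ler_wpM2r ?posdef_qform_ge0// lerXn2r// nnegrE (le_trans a0).
Qed.

(** By induction: [V (x_(k+1)) <= 2 V (xi_k) + 2 alpha_k^2 V (w_k)], and the
dissipation inequality bounds [V (xi_k)] by [V (x_k)]. *)
Lemma energy_integrable k :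
  Pr.-integrable setT (EFin \o (fun omega => qform P (x k omega))).
Proof.
elim: k => [|k IH].
  rewrite /comp; under eq_fun do rewrite xinit.
  exact: finite_measure_integrable_cst.
apply: (@le_integrableR _ _ _ _ _ (fun omega => 2 * qform P (x k omega)
   + (2 * abar ^+ 2) * qform P (noise w k omega))).
- by apply: measurable_qform => i; exact: state_measurable.
- move=> t; rewrite ger0_norm ?posdef_qform_ge0// xS.
  have := qformD_le (xi k t) (alpha k t *: noise w k t) P0.
  rewrite (qformZ _ (alpha k t)).
  have := noise_gain_le k t; have := dissipation k t.
  have := dotv_ge0 (x k t); lra.
- apply: integrableDR; apply: integrableZR => //.
  exact: (qform_noise_integrable hw).
Qed.

Lemma state_sqr_integrable k :
  Pr.-integrable setT (EFin \o (fun omega => dotv (x k omega) (x k omega))).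
Proof.
apply: le_integrableR (energy_integrable k).
  by apply: measurable_dotv => i; exact: state_measurable.
move=> t; rewrite ger0_norm ?dotv_ge0//.
by have := dissipation k t; have := posdef_qform_ge0 (xi k t) P0; lra.
Qed.

(** The coefficient of the i-th noise coordinate in the cross term
[alpha_k (P xi_k)^T w_k]: orthogonality to the history is available one
noise coordinate at a time. *)
Let coef k i omega := alpha k omega * (P *m xi k omega) i 0.

Lemma coef_adapted k i : adapted alpha w k (coef k i).
Proof.
apply: measurable_funM; first exact: adapted_step.
under eq_fun do rewrite mxE.
apply: measurable_sum => j; apply: measurable_funM; first exact: measurable_cst.
exact: (drift_adapted (@state_adapted k) j).
Qed.

Lemma cross_coord_integrable k i :
  Pr.-integrable setT (EFin \o (fun omega => w k i omega * coef k i omega)).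
Proof.
apply: (@le_integrableR _ _ _ _ _ (fun omega => abar * qform P (x k omega)
   + (abar * P i i) * w k i omega ^+ 2)).
- apply: measurable_funM => //.
  exact: (adapted_measurable (@coef_adapted k i)).
- move=> t; have /andP[a0 aM] := alphaI k t.
  rewrite /coef mulrCA normrM (ger0_norm a0) [_ * (P *m _) _ _]mulrC.
  have := cross_term_bound (xi k t) (w k i t) i P0.
  have := dissipation k t; have := dotv_ge0 (x k t).
  have := posdef_qform_ge0 (xi k t) P0.
  move: (`|_ * w k i t|) (normr_ge0 ((P *m xi k t) i 0 * w k i t)) => N N0.
  rewrite -mulrA -mulrDr => q0 d0 dis cb.
  apply: (le_trans (ler_wpM2r N0 aM)); rewrite ler_wpM2l//; lra.
- apply: integrableDR; apply: integrableZR.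
    exact: energy_integrable.
  exact: (white_noise_sqr_integrable hw).
Qed.

Let cross k omega := \sum_i w k i omega * coef k i omega.

Lemma cross_integrable k : Pr.-integrable setT (EFin \o cross k).
Proof.
rewrite /comp /cross; under eq_fun do rewrite -sumEFin.
by apply: integrable_sum => // i _; exact: cross_coord_integrable.
Qed.

Lemma expectation_cross k : \int[Pr]_omega cross k omega = 0.
Proof.
rewrite /Rintegral /cross; under eq_integral do rewrite -sumEFin.
rewrite integral_sum//; last by move=> i; exact: cross_coord_integrable.
rewrite big1// => i _; apply/eqP; rewrite -fine_eq0; last first.
  by apply: integrable_fin_num => //; exact: cross_coord_integrable.
apply/eqP; apply: (expectation_adapted_noise hw (@coef_adapted k i)).
exact: cross_coord_integrable.
Qed.

Lemma energyS_le k omega :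
  qform P (x k.+1 omega) + dotv (x k omega) (x k omega) <=
  qform P (x k omega) + (2 * cross k omega
    + abar ^+ 2 * qform P (noise w k omega)).
Proof.
rewrite xS (qformD (xi k omega)) ?(proj1 P0)// qformZ.
have -> : dotv (P *m xi k omega) (alpha k omega *: noise w k omega) =
    cross k omega.
  rewrite dotvE; apply: eq_bigr => i _; rewrite /coef !mxE; ring.
by have := noise_gain_le k omega; have := dissipation k omega; lra.
Qed.

Lemma expected_energyS_le k :
  \int[Pr]_omega qform P (x k.+1 omega)
  + \int[Pr]_omega dotv (x k omega) (x k omega) <=
  \int[Pr]_omega qform P (x k omega) + abar ^+ 2 * \tr P.
Proof.
have iV j := energy_integrable j; have iD := state_sqr_integrable k.
have iC := cross_integrable k; have iN := qform_noise_integrable hw P k.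
have iC2 := integrableZR 2 iC; have iN2 := integrableZR (abar ^+ 2) iN.
have iCN := integrableDR iC2 iN2.
rewrite -(expectation_qform_noise hw P k) -RintegralD//.
rewrite -RintegralZl// -[leRHS]addr0.
have -> : 0 = \int[Pr]_omega (2 * cross k omega).
  by rewrite RintegralZl// expectation_cross mulr0.
rewrite -addrA [X in _ + X]addrC -RintegralD// -RintegralD//.
apply: le_Rintegral => //; last by move=> t _; exact: energyS_le.
- exact: integrableDR.
- exact: integrableDR.
Qed.

(** The one-step inequality telescopes; the final energy is nonnegative and is
dropped. *)
Lemma sum_mean_square_le N :
  \sum_(0 <= k < N) \int[Pr]_omega dotv (x k omega) (x k omega) <=
  qform P x0 + N%:R * (abar ^+ 2 * \tr P).
Proof.
suff : \int[Pr]_omega qform P (x N omega) +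
    \sum_(0 <= k < N) \int[Pr]_omega dotv (x k omega) (x k omega) <=
    qform P x0 + N%:R * (abar ^+ 2 * \tr P).
  apply: le_trans; rewrite lerDr; apply: Rintegral_ge0 => t _.
  exact: posdef_qform_ge0.
elim: N => [|N IH].
  rewrite big_geq// addr0 mul0r addr0.
  under eq_Rintegral do rewrite xinit.
  rewrite Rintegral_cst//.
  rewrite [X in fine X](_ : _ = 1%E); last exact: probability_setT.
  by rewrite /= mulr1.
rewrite big_nat_recr//= mulrSr mulrDl mul1r.
have := expected_energyS_le N; move: IH; lra.
Qed.

Lemma mean_square_average_le N :
  (mean_square_average Pr x N.+1 <=
    (N.+1%:R^-1 * (qform P x0 + N.+2%:R * (abar ^+ 2 * \tr P)))%:E)%E.
Proof.
rewrite /mean_square_average EFinM lee_wpmul2l ?lee_fin//.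
apply: le_trans (_ : ((\sum_(0 <= k < N.+2)
   \int[Pr]_omega dotv (x k omega) (x k omega))%:E <= _)%E); last first.
  by rewrite lee_fin sum_mean_square_le.
rewrite -sumEFin; apply: lee_sum => k _.
rewrite unlock /Rintegral fineK; last first.
  by apply: integrable_fin_num => //; exact: state_sqr_integrable.
by under [leLHS]eq_integral do rewrite /= enorm_sqr.
Qed.

(** The average over [N] has [N + 1] terms, so the bound on it is
[B + (V(x0) + B) / N] with [B = abar^2 tr P], and tends to [B]. *)
Lemma lim_mean_square_average_le : cvgn (mean_square_average Pr x) ->
  (limn (mean_square_average Pr x) <= (abar ^+ 2 * \tr P)%:E)%E.
Proof.
move=> hlim; apply/lee_addgt0Pr => e e0.
apply: lime_le => //.
set B := abar ^+ 2 * \tr P; set C := qform P x0 + B.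
near=> N.
have N0 : (0 < N)%N by near: N; exact: nbhs_infty_gt.
(* From this index on, the excess C / N over B is at most e. *)
have hN : C / e <= N%:R by near: N; exact: nbhs_infty_ger.
rewrite -(prednK N0); apply: le_trans (mean_square_average_le _) _.
rewrite prednK// -EFinD lee_fin -/B ler_pdivrMl ?ltr0n//.
rewrite -natr1 mulrDl mul1r.
rewrite ler_pdivrMr// in hN; rewrite /C in hN; lra.
Unshelve. all: by end_near.
Qed.

End ClosedLoop.

Theorem theorem2 (R : realType) (n : nat)
    (d : measure_display) (Omega : measurableType d)
    (Pr : probability Omega R)
    (c L m : R) (f : 'cV[R]_n -> R) (phi : 'cV[R]_n -> 'cV[R]_n)
    (alpha : nat -> {RV Pr >-> R}) (w : nat -> 'I_n -> {RV Pr >-> R})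
    (x0 : 'cV[R]_n) (x y u e : nat -> Omega -> 'cV[R]_n)
    (M : 'M[R]_(n + n)) (P : 'M[R]_n) (lambda : R)
    (hc : 1 <= c) (hL : 0 < L) (hm : 0 < m)
    (hf_convex : strongly_convex m f)
    (hf_grad : is_gradient f phi)
    (hphi_lip : elipschitz L phi)
    (hf_min : forall z : 'cV[R]_n, z != 0 -> f 0 < f z)
    (halpha : forall k omega, step_sizes c L (alpha k omega))
    (hw : white_noise alpha w)
    (hx0 : forall omega, x 0%N omega = x0)
    (hx : forall k omega, x k.+1 omega =
            gd_A n *m x k omega + gd_Bu n (alpha k omega) *m u k omega
            + gd_Bw n (alpha k omega) *m noise w k omega)
    (hy : forall k omega, y k omega = gd_Cy n *m x k omega)
    (he : forall k omega, e k omega = gd_Ce n *m x k omega)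
    (hu : forall k omega, u k omega = phi (y k omega))
    (hM : M^T = M)
    (hIQC : pointwise_IQC M phi)
    (hP : posdef P)
    (hlambda : 0 <= lambda)
    (hLMI : forall a, step_sizes c L a -> negsemidef (gd_lmi P lambda M a))
    (hlim : cvgn (mean_square_average Pr x)) :
  (noise_amplification Pr x <=
     (sup [set Num.sqrt (\tr ((gd_Bw n a)^T *m P *m gd_Bw n a))
          | a in step_sizes c L])%:E)%E.
Proof.
have c0 : 0 < c by rewrite (lt_le_trans ltr01).
have abar0 : 0 <= c / L by rewrite divr_ge0// ltW.
have steps a : step_sizes c L a -> 0 <= a <= c / L.
  rewrite /step_sizes /= in_itv/= => /andP[a1 ->]; rewrite andbT.
  by apply: le_trans a1; rewrite divr_ge0// mulr_ge0// ltW.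
have abarA : step_sizes c L (c / L).
  rewrite /step_sizes /= in_itv/= lexx andbT ler_pdivrMr ?mulr_gt0//.
  by rewrite mulrCA divfK ?gt_eqF//; nra.
have iqc z : 0 <= qform M (col_mx z (phi z)).
  exact: (hIQC (fun=> z) (fun=> phi z) _ 0%N).
have trP0 : 0 <= \tr P.
  apply: sumr_ge0 => i _.
  (* At x = 0 and t = 1, the bound on cross terms says that P i i >= 0. *)
  have := cross_term_bound 0 1 i hP.
  have -> : qform P 0 = 0 by rewrite /qform mulmx0 mxE.
  rewrite expr1n !mulr1 add0r => h; apply: le_trans h.
  by rewrite mulr_ge0.
have trB a : \tr ((gd_Bw n a)^T *m P *m gd_Bw n a) = a ^+ 2 * \tr P.
  rewrite /gd_Bw tr_scalar_mx mul_scalar_mx mul_mx_scalar scalerA.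
  by rewrite mxtraceZ expr2.
have step k omega : x k.+1 omega = x k omega
    - alpha k omega *: phi (x k omega) + alpha k omega *: noise w k omega.
  rewrite hx hu hy /gd_A /gd_Bu /gd_Bw /gd_Cy !mul1mx !mul_scalar_mx.
  by rewrite scaleNr.
have diss k omega := lmi_dissipation (proj1 hP) hlambda
  (hLMI _ (halpha k omega)) (iqc (x k omega)).
have := @lim_mean_square_average_le _ _ _ _ _ _ _ P phi L (c / L) x0 x
  hw hP (ltW hL) hphi_lip (fun k omega => steps _ (halpha k omega))
  hx0 step diss hlim.
rewrite /noise_amplification => lim_le.
apply: (@le_trans _ _ (Num.sqrt ((c / L) ^+ 2 * \tr P))%:E).
  rewrite -[leRHS]/(sqrte _%:E) lee_sqrt// lee_fin.
  by rewrite mulr_ge0// sqr_ge0.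
rewrite lee_fin; apply: ub_le_sup; last by exists (c / L) => //; rewrite trB.
exists (Num.sqrt ((c / L) ^+ 2 * \tr P)) => _ [a /steps /andP[a0 ac] <-].
by rewrite trB ler_wsqrtr// ler_wpM2r// lerXn2r// nnegrE.
Qed.
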